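(* Let $X$ be a countably infinite set. Then the topological spaces $\mathbf{AF}^X_{weak}$ and $\mathbf{LF}^X_{str}$ are both homeomorphic to the Baire space $\mathbb{N}^{\mathbb{N}}$ (the product of countably many copies of the discrete space $\mathbb{N}$).
   Context: For a set $X$, a quiver on $X$ is a function $Q:X\times X\to\mathbb{Z}$ with $Q(x,y)=-Q(y,x)$ for all $x,y\in X$ ($Q(x,y)$ is the signed number of arrows from $x$ to $y$). $\mathbf{AF}^X$ denotes the set of all quivers on $X$. $Q$ is locally finite if $\sum_{y\in X}|Q(x,y)|<\infty$ for every $x\in X$; $\mathbf{LF}^X\subseteq\mathbf{AF}^X$ is the set of locally finite quivers. For $V\subseteq X$, the restriction $\rho_V(Q)$ is the quiver on $X$ with $\rho_V(Q)(x,y)=Q(x,y)$ if $x,y\in V$ and $0$ otherwise; the overfill $\lambda_V(Q)$ is the quiver on $X$ with $\lambda_V(Q)(x,y)=Q(x,y)$ if $x\in V$ or $y\in V$, and $0$ otherwise. For $Q\in\mathbf{AF}^X$ and finite $V\subseteq X$ let $U_{Q,V}=\{Q'\in\mathbf{AF}^X:\rho_V(Q')=\rho_V(Q)\}$ and $W_{Q,V}=\{Q'\in\mathbf{AF}^X:\lambda_V(Q')=\lambda_V(Q)\}$. The weak topology on $\mathbf{AF}^X$ is the topology with basis $\{U_{Q,V}\}$, the strong topology is the one with basis $\{W_{Q,V}\}$; $\mathbf{AF}^X_{weak}$, $\mathbf{AF}^X_{str}$ denote these spaces, and $\mathbf{LF}^X_{str}$ denotes $\mathbf{LF}^X$ with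 the subspace topology from $\mathbf{AF}^X_{str}$. $\mathbb{N}$ denotes the positive integers. *)

(* Defs.v *)
From HB Require Import structures.
From mathcomp Require Import all_boot all_order all_algebra.
From mathcomp Require Import all_classical all_reals all_analysis Rstruct.
From Stdlib Require Rdefinitions.

Set Implicit Arguments.
Unset Strict Implicit.
Unset Printing Implicit Defensive.

Import Order.TTheory GRing.Theory Num.Theory.

Local Open Scope classical_set_scope.
Local Open Scope ring_scope.

Record quiver (X : Type) := Quiver {
  arrows :> X -> X -> int ;
  arrowsN : forall x y, arrows x y = - arrows y x }.

Lemma quiverP (X : Type) (Q Q' : quiver X) :
  (forall x y, Q x y = Q' x y) -> Q = Q'.
Proof.
case: Q Q' => [q qN] [q' q'N] /= qq'.
have eqq : q = q' by apply/funext => x; apply/funext => y.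
by case: _ / eqq q'N {qq'} => q'N; rewrite (Prop_irrelevance qN q'N).
Qed.

Definition quiver0 (X : Type) : quiver X :=
  @Quiver X (fun _ _ => 0) (fun _ _ => esym (oppr0 _)).

HB.instance Definition _ (X : Type) := gen_eqMixin (quiver X).
HB.instance Definition _ (X : Type) := gen_choiceMixin (quiver X).
HB.instance Definition _ (X : Type) := isPointed.Build (quiver X) (quiver0 X).

Section restriction_overfill.
Context {X : Type} (V : set X).

Lemma restriction_subproof (Q : quiver X) (x y : X) :
  (if (x \in V) && (y \in V) then Q x y else 0) =
  - (if (y \in V) && (x \in V) then Q y x else 0).
Proof. by rewrite andbC; case: ifP; rewrite ?oppr0 -?arrowsN. Qed.

Definition restriction (Q : quiver X) : quiver X :=
  Quiver (restriction_subproof Q).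

Lemma overfill_subproof (Q : quiver X) (x y : X) :
  (if (x \in V) || (y \in V) then Q x y else 0) =
  - (if (y \in V) || (x \in V) then Q y x else 0).
Proof. by rewrite orbC; case: ifP; rewrite ?oppr0 -?arrowsN. Qed.

Definition overfill (Q : quiver X) : quiver X :=
  Quiver (overfill_subproof Q).

End restriction_overfill.

Lemma restriction_sub (X : Type) (V W : set X) (Q Q' : quiver X) :
  V `<=` W -> restriction W Q = restriction W Q' ->
  restriction V Q = restriction V Q'.
Proof.
move=> VW QQ'; apply: quiverP => x y /=.
case: ifP => // /andP[/set_mem/VW/mem_set xW /set_mem/VW/mem_set yW].
by move: (congr1 (fun q : quiver X => q x y) QQ') => /=; rewrite xW yW.
Qed.

Lemma overfill_sub (X : Type) (V W : set X) (Q Q' : quiver X) :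
  V `<=` W -> overfill W Q = overfill W Q' ->
  overfill V Q = overfill V Q'.
Proof.
move=> VW QQ'; apply: quiverP => x y /=; case: ifP => // xyV.
move: (congr1 (fun q : quiver X => q x y) QQ') => /=.
by case/orP: xyV => /set_mem/VW/mem_set ->; rewrite ?orbT.
Qed.

Definition weak_basic {X : Type} (i : quiver X * set X) : set (quiver X) :=
  [set Q' | restriction i.2 Q' = restriction i.2 i.1].

Definition strong_basic {X : Type} (i : quiver X * set X) : set (quiver X) :=
  [set Q' | overfill i.2 Q' = overfill i.2 i.1].

Definition basic_index {X : Type} : set (quiver X * set X) :=
  [set i | finite_set i.2].

Lemma weak_basic_cover (X : Type) :
  \bigcup_(i in @basic_index X) weak_basic i = [set: quiver X].
Proof. by rewrite -subTset => Q _; exists (Q, set0) => //=; exact: finite_set0. Qed.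

Lemma strong_basic_cover (X : Type) :
  \bigcup_(i in @basic_index X) strong_basic i = [set: quiver X].
Proof. by rewrite -subTset => Q _; exists (Q, set0) => //=; exact: finite_set0. Qed.

Lemma weak_basic_join (X : Type) (i j : quiver X * set X) (Q : quiver X) :
  basic_index i -> basic_index j -> weak_basic i Q -> weak_basic j Q ->
  exists k, [/\ basic_index k, weak_basic k Q &
                weak_basic k `<=` weak_basic i `&` weak_basic j].
Proof.
move=> fi fj iQ jQ; exists (Q, i.2 `|` j.2).
split=> //=; first by rewrite /basic_index /= finite_setU.
move=> Q' QQ'; split.
- exact: etrans (restriction_sub (@subsetUl _ _ _) QQ') iQ.
- exact: etrans (restriction_sub (@subsetUr _ _ _) QQ') jQ.
Qed.

Lemma strong_basic_join (X : Type) (i j : quiver X * set X) (Q : quiver X) :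
  basic_index i -> basic_index j -> strong_basic i Q -> strong_basic j Q ->
  exists k, [/\ basic_index k, strong_basic k Q &
                strong_basic k `<=` strong_basic i `&` strong_basic j].
Proof.
move=> fi fj iQ jQ; exists (Q, i.2 `|` j.2).
split=> //=; first by rewrite /basic_index /= finite_setU.
move=> Q' QQ'; split.
- exact: etrans (overfill_sub (@subsetUl _ _ _) QQ') iQ.
- exact: etrans (overfill_sub (@subsetUr _ _ _) QQ') jQ.
Qed.

(* [AF_weak X] and [AF_str X] are two copies of the type of all quivers on [X],
   so that each can carry its own topology. *)
Definition AF_weak (X : Type) : Type := quiver X.
Definition AF_str (X : Type) : Type := quiver X.

HB.instance Definition _ (X : Type) := Choice.on (AF_weak X).
HB.instance Definition _ (X : Type) := isBaseTopological.Build (AF_weak X)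
  (@weak_basic_cover X) (@weak_basic_join X).

HB.instance Definition _ (X : Type) := Choice.on (AF_str X).
HB.instance Definition _ (X : Type) := isBaseTopological.Build (AF_str X)
  (@strong_basic_cover X) (@strong_basic_join X).

Definition locally_finite (X : choiceType) (Q : quiver X) : Prop :=
  forall x : X,
    summable [set: X] (fun y => ((Q x y)%:~R : Rdefinitions.R)%:E).

Definition LF (X : choiceType) : set (AF_str X) :=
  [set Q | locally_finite Q].

(* The library topologizes a set coerced to a type by the subspace topology. *)
Definition LF_str (X : choiceType) : topologicalType := set_type (@LF X).

(* The natural numbers start at 1 here. *)
Definition posnat : Type := {n : nat | (0 < n)%N}.

HB.instance Definition _ := Choice.on posnat.

Definition baire_space : topologicalType :=
  prod_topology (fun _ : posnat => discrete_topology posnat).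

Definition homeomorphic (S T : topologicalType) : Prop :=
  exists (f : S -> T) (g : T -> S),
    [/\ cancel f g, cancel g f, continuous f & continuous g].

(* Main.v *)
(** Enumerating [X] by the natural numbers identifies a quiver with its
    sequence of rows, the [i]-th row listing the arrows from the [i]-th vertex
    to the later ones.  A quiver is thus a free choice of integers indexed by
    pairs of naturals, and fixing [restriction V Q] for finite [V] amounts to
    fixing finitely many of them: [AF_weak X] is a countable power of a discrete
    countably infinite set.  A quiver is locally finite iff all of its rows have
    finite support, because a vertex has only finitely many predecessors in the
    enumeration; fixing [overfill V Q] for finite [V] amounts to fixing finitely
    many rows.  Finitely supported rows are polynomials over [int], and they
    form a countably infinite set, so [LF_str X] is again such a power. *)

Require Import Defs.
From mathcomp Require Import all_boot all_order all_algebra.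
From mathcomp Require Import all_classical all_reals all_analysis.
From mathcomp Require Import finmap Rstruct zify.

Set Implicit Arguments.
Unset Strict Implicit.
Unset Printing Implicit Defensive.

Import Order.TTheory GRing.Theory Num.Theory.

Local Open Scope classical_set_scope.
Local Open Scope ring_scope.

(** * Countably infinite sets *)

Lemma bijective_nat (T : Type) :
  countable [set: T] -> infinite_set [set: T] ->
  exists f : T -> nat, bijective f.
Proof.
move=> cT iT; have /card_set_bijP[f] := eq_card_nat cT iT.
by rewrite setTT_bijective; exists f.
Qed.

Lemma bijective_countable_infinite (T U : Type) :
  countable [set: T] -> infinite_set [set: T] ->
  countable [set: U] -> infinite_set [set: U] ->
  exists f : T -> U, bijective f.
Proof.
move=> cT iT cU iU; have [f bij_f] := bijective_nat cT iT.
have [g [g' gK g'K]] := bijective_nat cU iU.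
by exists (g' \o f); apply: bij_comp bij_f; exists g.
Qed.

Lemma inj_infinite_setT (T U : Type) (f : T -> U) :
  injective f -> infinite_set [set: T] -> infinite_set [set: U].
Proof.
move=> f_inj; apply: contra_not => finU.
by rewrite -(preimage_setT f); apply: finite_preimage => // x y _ _ /f_inj.
Qed.

Lemma posnat_infinite : infinite_set [set: posnat].
Proof.
apply: (@inj_infinite_setT nat _ (fun n => exist _ n.+1 (ltn0Sn n))).
  by move=> m n [].
exact: infinite_nat.
Qed.

Lemma posnat_countable : countable [set: posnat].
Proof. exact: (@countableP {n : nat | (0 < n)%N}). Qed.

(** * Recognizing the Baire space *)

Lemma proj_baire_near (h : baire_space) (n : posnat) :
  \forall h' \near h, h' n = h n.
Proof.
have := @proj_continuous _ (fun _ : posnat => discrete_topology posnat) n h.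
by move=> /(_ _ (discrete_set1 _)).
Qed.

Lemma filter_in_seq (T : Type) (F : set_system T) (I : eqType)
    (P : I -> T -> Prop) (J : seq I) :
  Filter F -> (forall i, \forall x \near F, P i x) ->
  \forall x \near F, {in J, forall i, P i x}.
Proof.
move=> FF FP; elim: J => [|i J IH]; first by apply: nearW => x j.
apply: filterS2 (FP i) IH => x Pix PJx j.
by rewrite inE => /predU1P[->//|/PJx].
Qed.

(** The hypotheses on [c] and [d] say that [S] is the power of the discrete set [K] over the index
    set [I]: local constancy of each coordinate is continuity of [c], and the condition on [nbhs] is
    continuity of its inverse [d]. Bijections of [I] and [K] with [posnat] then relabel indices and
    values. *)
Lemma homeomorphic_baire (S : topologicalType) (I : eqType) (K : Type)
    (c : S -> I -> K) (d : (I -> K) -> S) :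
  countable [set: I] -> infinite_set [set: I] ->
  countable [set: K] -> infinite_set [set: K] ->
  cancel c d -> cancel d c ->
  (forall s i, \forall s' \near s, c s' i = c s i) ->
  (forall s A, nbhs s A -> exists J : seq I, forall s',
     {in J, c s' =1 c s} -> A s') ->
  homeomorphic S baire_space.
Proof.
move=> cI iI cK iK cd dc c_near nbhs_c.
have [a [a' aK a'K]] := bijective_countable_infinite
  posnat_countable posnat_infinite cI iI.
have [b [b' bK b'K]] := bijective_countable_infinite
  cK iK posnat_countable posnat_infinite.
pose g (h : baire_space) := d (fun i => b' (h (a' i))).
exists (fun s n => b (c s (a n))), g; split.
- by move=> s; rewrite -[RHS]cd; congr d; apply/funext => i; rewrite a'K bK.
- by move=> h; apply/funext => n; rewrite dc aK b'K.
(* Convergence in the product is tested one coordinate at a time, and each coordinate is locally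
   constant. *)
- move=> s; apply/cvg_sup => n U [_ [[B _ <-] Bs BU]].
  by apply: filterS (c_near s (a n)) => s' cs'; apply: BU => /=; rewrite cs'.
- move=> h A /nbhs_c[J AJ].
  have near_g i : \forall h' \near h, c (g h') i = c (g h) i.
    by apply: filterS (proj_baire_near h (a' i)) => h' hi; rewrite /g !dc hi.
  have := filter_in_seq J (nbhs_filter h) near_g.
  by apply: filterS => h'; exact: AJ.
Qed.

(** * Neighbourhoods in the quiver spaces *)

Lemma nbhs_AF_weak (X : Type) (Q : AF_weak X) (A : set (AF_weak X)) :
  nbhs Q A <-> exists2 V : set X, finite_set V &
    forall Q', restriction V Q' = restriction V Q -> A Q'.
Proof.
split=> [[_ [[D fD <-] [[Q0 V] DQV QV] sA]]|[V fV VA]].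
  (* Membership in a basic set is an equality of restrictions, so a basic set containing [Q] can be
     recentred at [Q] with the same [V]. *)
  by exists V; [exact: fD DQV|move=> Q' Q'Q; apply: sA; exists (Q0, V) => //;
    exact: etrans Q'Q QV].
exists (weak_basic (Q, V)); split => //.
by exists [set (Q, V)]; [move=> _ -> | rewrite bigcup_set1].
Qed.

Lemma nbhs_AF_str (X : Type) (Q : AF_str X) (A : set (AF_str X)) :
  nbhs Q A <-> exists2 V : set X, finite_set V &
    forall Q', overfill V Q' = overfill V Q -> A Q'.
Proof.
split=> [[_ [[D fD <-] [[Q0 V] DQV QV] sA]]|[V fV VA]].
  by exists V; [exact: fD DQV|move=> Q' Q'Q; apply: sA; exists (Q0, V) => //;
    exact: etrans Q'Q QV].
exists (strong_basic (Q, V)); split => //.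
by exists [set (Q, V)]; [move=> _ -> | rewrite bigcup_set1].
Qed.

Lemma nbhs_set_type (T : topologicalType) (L : set T) (s : L) (A : set L) :
  nbhs s A <-> exists2 B, nbhs (set_val s) B & set_val @^-1` B `<=` A.
Proof.
split=> [[_ [[B oB <-] Bs BA]]|[B Bs BA]].
  by exists B => //; exact: open_nbhs_nbhs.
by apply: filterS BA _; exact: (@initial_continuous L T set_val s).
Qed.

Lemma restriction_arrows (X : Type) (V : set X) (Q Q' : quiver X) (x y : X) :
  restriction V Q = restriction V Q' -> V x -> V y -> Q x y = Q' x y.
Proof.
move=> /(congr1 (fun q : quiver X => q x y)) /= + /mem_set Vx /mem_set Vy.
by rewrite Vx Vy.
Qed.

Lemma overfill_arrows (X : Type) (V : set X) (Q Q' : quiver X) (x y : X) :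
  overfill V Q = overfill V Q' -> V x -> Q x y = Q' x y.
Proof.
by move=> /(congr1 (fun q : quiver X => q x y)) /= + /mem_set Vx; rewrite Vx.
Qed.

Lemma summable_intP (T : choiceType) (f : T -> int) :
  summable [set: T] (fun y => ((f y)%:~R : Rdefinitions.R)%:E) <->
  finite_set [set y | f y != 0].
Proof.
pose F y : \bar Rdefinitions.R := `|((f y)%:~R)%:E|%E.
rewrite /summable -/F; have F0 y : (0 <= F y)%E by exact: abse_ge0.
split=> [fin_sum|fin_supp].
  apply: contrapT => inf_supp.
  suff sumF : (\esum_(y in [set: T]) F y = +oo)%E by rewrite sumF in fin_sum.
  apply/eqyP => r r0.
  (* A finite part [B] of the support with more than [r] elements: a nonzero integer has absolute
     value at least 1, so the sum over [B] exceeds [r]. *)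
  have [B BA Br] := infinite_set_fset (Num.truncn r).+1 inf_supp.
  apply: esum_ge; exists [set` B] => //.
  apply: (@le_trans _ _ (Num.truncn r).+1%:R%:E).
    by rewrite lee_fin ltW// truncnS_gt.
  move: Br; rewrite -(@ler_nat Rdefinitions.R) -lee_fin => /le_trans; apply.
  rewrite fsbig_finite//= set_fsetK card_fset_sum1 natr_sum -sumEFin.
  rewrite big_seq [leRHS]big_seq; apply: lee_sum => y yB.
  rewrite /F lee_fin -intr_norm ler1z -gtz0_ge1 normr_gt0.
  exact: BA.
have -> : (\esum_(y in [set: T]) F y = \esum_(y in [set y | f y != 0%R]) F y)%E.
  rewrite [RHS]esum_mkcond; apply: eq_esum => y _.
  case: ifPn => //; rewrite notin_setE /F => /negP.
  by rewrite negbK => /eqP ->; rewrite abse0.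
by rewrite esum_fset// fsbig_finite//= /F; under eq_bigr do rewrite abse_EFin;
  rewrite sumEFin ltry.
Qed.

(** * Quivers as sequences of rows *)

Section rows.
Variables (X : choiceType) (e : X -> nat) (e' : nat -> X).
Hypotheses (eK : cancel e e') (e'K : cancel e' e).

(** Offset 0 is the vertex right after [i], so each unordered pair of distinct vertices has exactly
    one entry and antisymmetry puts no constraint on the entries. *)
Definition row (Q : quiver X) (i d : nat) : int := Q (e' i) (e' (i + d).+1).

Definition signed_entry (u : nat -> nat -> int) (i j : nat) : int :=
  if (i < j)%N then u i (j - i).-1
  else if (j < i)%N then - u j (i - j).-1 else 0.

Lemma signed_entryN u i j : signed_entry u i j = - signed_entry u j i.
Proof. by rewrite /signed_entry; case: ltngtP => // _; rewrite ?opprK ?oppr0. Qed.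

Definition of_rows (u : nat -> nat -> int) : quiver X :=
  @Quiver X (fun x y => signed_entry u (e x) (e y))
    (fun x y => signed_entryN u (e x) (e y)).

Lemma row_of_rows u : row (of_rows u) = u.
Proof.
apply/funext => i; apply/funext => d.
rewrite /row /= /signed_entry !e'K; have -> : (i < (i + d).+1)%N by lia.
by congr u; lia.
Qed.

(** The entry for a pair sits in the row of its earlier vertex; antisymmetry recovers the other
    orientation and forces 0 on the diagonal. *)
Lemma eq_arrows (Q Q' : quiver X) (x y : X) :
  (let m := minn (e x) (e y) in
   let d := (maxn (e x) (e y) - m).-1 in row Q m d = row Q' m d) ->
  Q x y = Q' x y.
Proof.
rewrite /row /=; case: (ltngtP (e x) (e y)) => [xy|yx|xy _].
- have -> : (e x + (e y - e x).-1).+1 = e y by lia.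
  by rewrite !eK.
- have -> : (e y + (e x - e y).-1).+1 = e x by lia.
  by rewrite !eK => QQ'; rewrite arrowsN QQ' -arrowsN.
- have loop0 (q : quiver X) : q x x = 0 by have := arrowsN q x x; lia.
  by rewrite -(can_inj eK xy) !loop0.
Qed.

Lemma row_inj : injective row.
Proof. by move=> Q Q' QQ'; apply: quiverP => x y; apply: eq_arrows; rewrite QQ'. Qed.

Lemma rowK : cancel row of_rows.
Proof. by move=> Q; apply: row_inj; rewrite row_of_rows. Qed.

Lemma finite_set_lt (V : set X) :
  finite_set V -> exists N, forall x, V x -> (e x < N)%N.
Proof.
move=> /finite_seqP[s ->]; exists (\max_(x <- s) e x).+1 => x /= xs.
by rewrite ltnS; exact: leq_bigmax_seq.
Qed.

(** One bound serves for rows and offsets, since the difference of two indices below [N] is again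
    below [N]. *)
Lemma restriction_eq_rows (V : set X) (Q Q' : quiver X) (N : nat) :
  (forall x, V x -> (e x < N)%N) ->
  (forall i d, (i < N)%N -> (d < N)%N -> row Q i d = row Q' i d) ->
  restriction V Q = restriction V Q'.
Proof.
move=> VN QQ'; apply: quiverP => x y /=.
case: ifP => // /andP[/set_mem/VN xN /set_mem/VN yN].
by apply: eq_arrows; apply: QQ'; lia.
Qed.

(** A pair meeting [V] has its smaller index below [N], but its larger one is unbounded: whole rows
    have to agree. *)
Lemma overfill_eq_rows (V : set X) (Q Q' : quiver X) (N : nat) :
  (forall x, V x -> (e x < N)%N) ->
  (forall i, (i < N)%N -> row Q i = row Q' i) ->
  overfill V Q = overfill V Q'.
Proof.
move=> VN QQ'; apply: quiverP => x y /=.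
case: ifP => // xyV; apply: eq_arrows; rewrite /= QQ' //.
by case/orP: xyV => /set_mem/VN; lia.
Qed.

Lemma locally_finite_rows (Q : quiver X) :
  locally_finite Q <-> forall i, finite_set [set d | row Q i d != 0].
Proof.
have fin x : summable [set: X] (fun y => ((Q x y)%:~R : Rdefinitions.R)%:E) <->
  finite_set [set y | Q x y != 0] by exact: summable_intP.
split=> [lfQ i|finQ x].
  have /fin finQi := lfQ (e' i).
  apply: (@finite_preimage _ _ [set y | Q (e' i) y != 0]
    (fun d => e' (i + d).+1)) => // d d' _ _ /(can_inj e'K); lia.
apply/fin; pose late := [set d | row Q (e x) d != 0].
(* The neighbours of [x] lie among the finitely many vertices up to [x] and those given by the
   nonzero entries of its row. *)
apply: (@sub_finite_set _ _
  (e' @` `I_(e x).+1 `|` (fun d => e' (e x + d).+1) @` late)).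
  move=> y /= Qxy; have [yx|xy] := leqP (e y) (e x).
    by left; exists (e y) => //=.
  right; exists (e y - e x).-1; last by rewrite -[RHS]eK; congr e'; lia.
  rewrite /late /row /= eK; suff -> : (e x + (e y - e x).-1).+1 = e y by rewrite eK.
  lia.
rewrite finite_setU; split; apply: finite_image; last exact: finQ.
exact: finite_II.
Qed.

Lemma AF_weak_homeomorphic_baire : homeomorphic (AF_weak X) baire_space.
Proof.
apply: (@homeomorphic_baire (AF_weak X) (nat * nat)%type int
  (fun (Q : quiver X) p => row Q p.1 p.2) (fun u => of_rows (fun i d => u (i, d)))).
- exact: countableP.
- exact: infinite_prod_nat.
- exact: countableP.
- by apply: (@inj_infinite_setT nat _ Posz); [move=> m n []|exact: infinite_nat].
- exact: rowK.
- by move=> u; apply/funext => -[i d]; rewrite row_of_rows.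
- move=> Q [i d]; apply/nbhs_AF_weak.
  (* A single entry is fixed by the restriction to its two endpoints. *)
  exists [set e' i; e' (i + d).+1]; first exact: finite_set2.
  by move=> Q' Q'Q; apply: (restriction_arrows Q'Q); [left|right].
- move=> Q A /nbhs_AF_weak[V fV VA]; have [N VN] := finite_set_lt fV.
  exists [seq (i, d) | i <- iota 0 N, d <- iota 0 N] => Q' Q'Q.
  apply: VA; apply: (restriction_eq_rows VN) => i d iN dN.
  by apply: (Q'Q (i, d)); apply/allpairsP; exists (i, d); rewrite !mem_iota.
Qed.

(** * Finitely supported rows as polynomials *)

Definition poly_of (u : nat -> int) : {poly int} :=
  xget 0 [set p : {poly int} | forall d, p`_d = u d].

Lemma coef_poly_of (u : nat -> int) (d : nat) :
  finite_set [set k | u k != 0] -> (poly_of u)`_d = u d.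
Proof.
move=> /finite_seqP[s us].
(* Finite support makes the choice in [poly_of] succeed, so its value is not the default 0; the
   witness truncates [u] just after the largest index of the support. *)
suff /(xgetPex 0)/(_ d) : exists p : {poly int}, forall k, p`_k = u k by [].
exists (\poly_(k < (\max_(k <- s) k).+1) u k) => k; rewrite coef_poly ltnS.
case: ifPn => // kmax; apply/esym/eqP; apply: contraNT kmax => uk.
have ks : [set` s] k by rewrite -us.
exact: (@leq_bigmax_seq _ s xpredT id).
Qed.

Lemma poly_of_coef (p : {poly int}) : poly_of (fun d => p`_d) = p.
Proof.
apply/polyP => d; rewrite coef_poly_of//.
apply: (sub_finite_set _ (finite_II (size p))) => k /= pk.
by rewrite ltnNge; apply: contraNN pk => /(nth_default 0) ->.
Qed.

Lemma locally_finite_of_polys (u : nat -> {poly int}) :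
  locally_finite (of_rows (fun i d => (u i)`_d)).
Proof.
apply/locally_finite_rows => i; rewrite row_of_rows.
apply: (sub_finite_set _ (finite_II (size (u i)))) => k /= pk.
by rewrite ltnNge; apply: contraNN pk => /(nth_default 0) ->.
Qed.

Lemma LF_str_homeomorphic_baire : homeomorphic (LF_str X) baire_space.
Proof.
pose polys (Q : LF_str X) i := poly_of (row (set_val Q) i).
have rowE (Q : LF_str X) i d : (polys Q i)`_d = row (set_val Q) i d.
  have /locally_finite_rows finQ : locally_finite (set_val Q) by exact: set_valP.
  exact/coef_poly_of/finQ.
pose of_polys (u : nat -> {poly int}) : LF_str X :=
  exist _ (of_rows (fun i d => (u i)`_d) : AF_str X)
    (mem_set (locally_finite_of_polys u)).
apply: (@homeomorphic_baire (LF_str X) nat {poly int} polys of_polys).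
- exact: countableP.
- exact: infinite_nat.
- exact: countableP.
- apply: (@inj_infinite_setT nat _ (fun n => (n%:Z)%:P)) infinite_nat.
  by move=> m n /polyC_inj[].
- move=> Q; apply: val_inj; apply: row_inj; rewrite row_of_rows.
  by apply/funext => i; apply/funext => d; exact: rowE.
- by move=> u; apply/funext => i; rewrite /polys /= row_of_rows poly_of_coef.
- move=> Q i; apply/nbhs_set_type.
  (* The overfill of the single vertex [e' i] fixes all of row [i], hence its polynomial. *)
  exists [set Q' | row Q' i = row (set_val Q) i].
    apply/nbhs_AF_str; exists [set e' i]; first exact: finite_set1.
    by move=> Q' Q'Q; apply/funext => d; exact: overfill_arrows Q'Q (erefl _).
  by move=> Q' /= Q'Q; rewrite /polys Q'Q.
- move=> Q A /nbhs_set_type[B /nbhs_AF_str[V fV VB] BA].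
  have [N VN] := finite_set_lt fV.
  exists (iota 0 N) => Q' Q'Q; apply: BA; apply: VB.
  apply: (overfill_eq_rows VN) => i iN; apply/funext => d.
  by rewrite -!rowE Q'Q// mem_iota.
Qed.

End rows.

Theorem theorem1p1 (X : choiceType)
    (X_countable : countable [set: X]) (X_infinite : infinite_set [set: X]) :
  homeomorphic (AF_weak X) baire_space /\ homeomorphic (LF_str X) baire_space.
Proof.
have [e [e' eK e'K]] := bijective_nat X_countable X_infinite.
split; first exact: AF_weak_homeomorphic_baire eK e'K.
exact: LF_str_homeomorphic_baire eK e'K.
Qed.
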